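(* Let $m\ge1$ and let $w_m$ be the unique root of $-w+(1-w)^m$ in $(0,1)$. Let $I(t)$ be the independent set produced after $t$ steps by the greedy independent set algorithm run on the uniform attachment process. Then for any $\alpha<1/3$, almost surely $$\lim_{t\to\infty}t^{\alpha}\left|\frac{|I(t)|}{t}-w_m\right|=0.$$
   Context: Uniform attachment process (integer $m\ge1$): start with the single vertex $1$; for each $t\ge1$, vertex $t+1$ selects $m$ vertices from $[t]$ independently and uniformly at random (repetitions allowed) and is joined by an edge to each selected vertex. Greedy independent set algorithm: $I(1)=\{1\}$; $I(t+1)=I(t)\cup\{t+1\}$ if vertex $t+1$ selects no vertex of $I(t)$, and $I(t+1)=I(t)$ otherwise. *)

(* Defs.v *)
From HB Require Import structures.
From mathcomp Require Import all_boot all_order all_algebra finmap.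
From mathcomp Require Import all_classical all_reals all_analysis.

Set Implicit Arguments.
Unset Strict Implicit.
Unset Printing Implicit Defensive.

Import Order.TTheory GRing.Theory Num.Theory.
Import numFieldNormedType.Exports.

Local Open Scope classical_set_scope.
Local Open Scope ring_scope.

(* Mutual independence of the subfamily (X i), i in D: the product rule on
   every finite set of indices of D. *)
Definition mutually_independent (R : realType)
    (d : measure_display) (T : measurableType d) (P : probability T R)
    (d' : measure_display) (T' : measurableType d')
    (I : choiceType) (D : set I) (X : I -> {RV P >-> T'}) : Prop :=
  forall (J : {fset I}) (B : I -> set T'),
    (forall i, i \in J -> D i) ->
    (forall i, i \in J -> measurable (B i)) ->
    P (\bigcap_(i in [set` J]) (X i @^-1` B i)) =
    (\prod_(i <- J) P (X i @^-1` B i))%E.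

(* [sel v j] is the j-th vertex selected by vertex v. Vertices are numbered
   from 1 and only v >= 2 selects; the values of [sel] at v = 0, 1 are
   unconstrained and never used. *)
Definition uniform_attachment (R : realType)
    (d : measure_display) (T : measurableType d) (P : probability T R)
    (m : nat) (sel : nat -> 'I_m -> {RV P >-> nat}) : Prop :=
  (forall t (j : 'I_m) k, (1 <= t)%N -> (1 <= k <= t)%N ->
     P (sel t.+1 j @^-1` [set k]) = (t%:R^-1)%:E) /\
  mutually_independent [set i : nat * 'I_m | (2 <= i.1)%N]
    (fun i => sel i.1 i.2).

(* I(t) for one realization [s] of the selections; I(0) is a dummy value. *)
Fixpoint greedy_indep (m : nat) (s : nat -> 'I_m -> nat) (t : nat)
    : {fset nat} :=
  match t with
  | 0 => fset0
  | 1 => [fset 1%N]%fset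
  | (_.+1 as u).+1 =>
      if [forall j, s u.+1 j \notin greedy_indep s u]
      then (u.+1 |` greedy_indep s u)%fset
      else greedy_indep s u
  end.

(* Main.v *)
Require Import Defs.
From HB Require Import structures.
From mathcomp Require Import all_boot all_order all_algebra finmap.
From mathcomp Require Import all_classical all_reals all_analysis.
From mathcomp Require Import ring lra.

Set Implicit Arguments.
Unset Strict Implicit.
Unset Printing Implicit Defensive.

Import Order.TTheory GRing.Theory Num.Theory.
Import numFieldNormedType.Exports.

Local Open Scope classical_set_scope.
Local Open Scope ring_scope.

(* Write [X t = #|I(t)|] and [Y t = X t - w t]. Given I(t), vertex t + 1 joins with
   probability [(1 - X t / t) ^+ m], which is decreasing in [X t] and equals [w] at
   [X t = w t]; hence the drift of [Y] opposes [Y], and [E (Y t ^+ 2) <= t]. With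
   [alpha = (1 - 2 b) / 3] and [b > 0], Markov's inequality gives
   [P (|Y (k ^ 3)| >= k `^ (2 + b)) <= k `^ (- (1 + 2 b))], which is summable, so
   Borel-Cantelli controls [Y] along the cubes. Between consecutive cubes [Y] moves
   by [O(k ^ 2)], because its increments are bounded by 1. *)

Section fixpoint.
Variables (R : realType) (m : nat).
Implicit Types w x y : R.

Lemma onem_exp_le x y : x <= y -> y <= 1 -> (1 - y) ^+ m <= (1 - x) ^+ m.
Proof. by move=> xy y1; apply: lerXn2r; rewrite ?nnegrE; lra. Qed.

Lemma unique_fixpoint_onem_exp : (0 < m)%N ->
  exists w, unique (fun x => 0 < x < 1 /\ - x + (1 - x) ^+ m = 0) w.
Proof.
move=> m0; pose p : {poly R} := 'X - (1 - 'X) ^+ m.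
have pE x : p.[x] = x - (1 - x) ^+ m by rewrite /p !hornerE.
have p0 : p.[0] = -1 by rewrite pE subr0 expr1n sub0r.
have p1 : p.[1] = 1 by rewrite pE subrr expr0n gtn_eqF// subr0.
have p_inj x y : x < 1 -> y < 1 -> p.[x] = 0 -> p.[y] = 0 -> x = y.
  wlog xy : x y / x <= y => [h x1 y1 px py|x1 y1].
    by have [/h->|/ltW/h->] := leP x y.
  by rewrite !pE; have := onem_exp_le xy (ltW y1); lra.
have [|w /andP[w0 w1] /rootP pw] := @poly_ivt R p 0 1 ler01.
  by rewrite p0 p1 lerN10 ler01.
have w01 : 0 < w < 1.
  rewrite !lt_neqAle w0 w1 !andbT; apply/andP; split.
    by apply: contra_eq_neq pw => <-; rewrite p0; lra.
  by apply: contra_eq_neq pw => ->; rewrite p1; lra.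
exists w; split=> [|y [/andP[_ y1] py]].
  by split=> //; move: pw; rewrite pE; lra.
by apply: p_inj => //; [case/andP: w01|rewrite pE; lra].
Qed.

Lemma fixpoint_onem_exp_drift w x : w <= 1 -> x <= 1 ->
  (1 - w) ^+ m = w -> (x - w) * ((1 - x) ^+ m - w) <= 0.
Proof.
move=> w1 x1 wE; rewrite -[X in _ * (_ - X)]wE.
have [wx|/ltW xw] := leP w x.
  by rewrite mulr_ge0_le0 ?subr_ge0 ?subr_le0 ?onem_exp_le.
by rewrite mulr_le0_ge0 ?subr_le0 ?subr_ge0 ?onem_exp_le.
Qed.

End fixpoint.

Section power_sums.
Variable R : realType.
Implicit Type a : R.

Lemma riemannR_cvg0 a : 0 < a -> riemannR a @ \oo --> (0 : R).
Proof.
move=> a0; have -> : riemannR a = (@powR R ^~ a) \o harmonic.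
  by apply/funext => n; rewrite /= -powR_inv1// -powRrM mulN1r powRN.
apply: cvg_comp (powR_cvg0 a0) => A /cvg_harmonic.
by apply: (@filterS _ \oo) => n; apply; exact: harmonic_gt0.
Qed.

Lemma riemannR_le_telescope a n : 0 < a ->
  a * riemannR (1 + a) n.+1 <= riemannR a n - riemannR a n.+1.
Proof.
move=> a0; rewrite /riemannR; set x : R := n.+1%:R; set y : R := n.+2%:R.
have x0 : 0 < x by rewrite ltr0n.
have y0 : 0 < y by rewrite ltr0n.
have yx : y = x + 1 by rewrite /y -natr1.
have bernoulli : 1 + a / y <= (y / x) `^ a.
  rewrite /powR gt_eqF ?divr_gt0//; apply: le_trans (expR_ge1Dx _).
  rewrite lerD2l ler_pM2l// -[y / x]invrK invf_div lnV ?posrE ?divr_gt0// lerNr.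
  have -> : x / y = 1 - y^-1 by rewrite yx; field; lra.
  by apply: le_ln1Dx; rewrite ltrN2 invf_lt1// yx ltrDr.
have -> : (x `^ a)^-1 = (y / x) `^ a * (y `^ a)^-1.
  rewrite powRM ?invr_ge0 ?(ltW x0) ?(ltW y0)// mulrAC mulfV ?mul1r;
    last by rewrite gt_eqF ?powR_gt0.
  by rewrite -(powR_inv1 (ltW x0)) -powRrM mulN1r powRN.
rewrite powRD ?(gt_eqF y0) ?implybT// powRr1 ?(ltW y0)// invfM mulrA.
by rewrite -[X in _ - X]mul1r -mulrBl ler_pM2r ?invr_gt0 ?powR_gt0// lerBrDl.
Qed.

Lemma cvg_riemannR a : 1 < a -> cvgn (series (riemannR a)).
Proof.
move=> a1; pose b := a - 1; have b0 : 0 < b by rewrite /b subr_gt0.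
have -> : a = 1 + b by rewrite /b; ring.
have term_ge0 n : 0 <= riemannR (1 + b) n by apply/ltW/riemannR_gt0; lra.
apply: nondecreasing_is_cvgn; first exact: nondecreasing_series.
exists (1 + b^-1) => _ [n _ <-].
suff : series (riemannR (1 + b)) n.+1 <= 1 + b^-1 * (1 - riemannR b n).
  move=> le_Sn; apply: le_trans (le_trans _ le_Sn) _.
    exact: nondecreasing_series.
  rewrite lerD2l ler_piMr ?invr_ge0 ?(ltW b0)// gerBl.
  exact/ltW/riemannR_gt0/ltW.
elim: n => [|n IH].
  by rewrite seriesEnat /= big_nat1 /riemannR !powR1 invr1 subrr mulr0 addr0.
rewrite seriesSr; have := riemannR_le_telescope n b0.
rewrite -ler_pdivlMl// !mulrBr; move: IH; rewrite mulrBr mulr1; lra.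
Qed.

End power_sums.

Lemma ler_norm_telescope (R : numDomainType) (V : normedZmodType R)
    (Y : nat -> V) (L : R) s t :
  (forall i, `|Y i.+1 - Y i| <= L) -> (s <= t)%N ->
  `|Y t - Y s| <= L *+ (t - s).
Proof.
move=> YL st; rewrite -telescope_sumr//; apply: le_trans (ler_norm_sum _ _ _) _.
by rewrite -sumr_const_nat; apply: ler_sum.
Qed.

Lemma expn_bracket (p t : nat) : (0 < p)%N ->
  exists k, (k ^ p <= t < k.+1 ^ p)%N.
Proof.
move=> p0; have ex : exists k, (k ^ p <= t)%N by exists 0; rewrite exp0n.
have ub k : (k ^ p <= t)%N -> (k <= t)%N.
  move=> kt; apply: leq_trans kt; case: k => // k.
  by rewrite -[leqLHS]expn1 leq_pexp2l.
case: (ex_maxnP ex ub) => k kt kmax; exists k; rewrite kt ltnNge.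
by apply/negP => /kmax; rewrite ltnn.
Qed.

Lemma cube_gap_le (R : realDomainType) k t :
  (0 < k)%N -> (k ^ 3 <= t < k.+1 ^ 3)%N -> (t - k ^ 3)%:R <= 7 * k%:R ^+ 2 :> R.
Proof.
move=> k0 /andP[kt tk]; have k1 : 1 <= k%:R :> R by rewrite ler1n.
apply: (@le_trans _ _ ((k.+1 ^ 3)%:R - (k ^ 3)%:R)).
  by rewrite natrB// lerD2r ler_nat ltnW.
by rewrite !natrX -natr1; nra.
Qed.

Section cube_interpolation.
Variables (R : realType) (Y : nat -> R) (L alpha : R).
Hypothesis alpha_lt : alpha < 1 / 3.
Hypothesis Y_incr : forall t, `|Y t.+1 - Y t| <= L.

Let b : R := (1 - 3 * alpha) / 2.

(* Consecutive cubes around [t] differ by [O(k ^ 2)], which is [o(t `^ (1 - alpha))]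
   precisely because [alpha < 1 / 3]. *)
Lemma cube_interpolation_le k t : (0 < k)%N -> (k ^ 3 <= t < k.+1 ^ 3)%N ->
  `|Y (k ^ 3)%N| <= k%:R `^ (2 + b) ->
  t%:R `^ alpha * (`|Y t| / t%:R) <= (1 + 7 * L) * (k%:R `^ b)^-1.
Proof.
move=> k0 ktk Yk; have /andP[kt tk] := ktk.
have alpha3 := alpha_lt; have b0 : 0 < b by rewrite /b; lra.
have L0 : 0 <= L := le_trans (normr_ge0 _) (Y_incr 0).
have t0 : (0 : R) < t%:R by rewrite ltr0n (leq_trans _ kt)// expn_gt0 k0.
set K : R := k%:R in Yk *; have K1 : 1 <= K by rewrite ler1n.
have K0 : 0 < K by exact: lt_le_trans K1.
have gap : (t - k ^ 3)%:R <= 7 * K `^ (2 + b).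
  apply: (@le_trans _ _ (7 * K ^+ 2)); first exact: cube_gap_le.
  by rewrite ler_pM2l// -powR_mulrn ?(ltW K0)// ler_powR//; lra.
have Yt : `|Y t| <= (1 + 7 * L) * K `^ (2 + b).
  rewrite -[Y t](subrK (Y (k ^ 3)%N)); apply: le_trans (ler_normD _ _) _.
  rewrite mulrDl mul1r addrC lerD// (le_trans (ler_norm_telescope Y_incr kt))//.
  by rewrite -[leLHS]mulr_natr [7 * L]mulrC -mulrA ler_wpM2l.
have tK : t%:R `^ alpha / t%:R <= K `^ (- (2 + 2 * b)).
  have -> : t%:R `^ alpha / t%:R = t%:R `^ (- (1 - alpha)).
    by rewrite opprB powRD ?(gt_eqF t0) ?implybT// powR_inv1 ?ltW.
  have -> : K `^ (- (2 + 2 * b)) = (K ^+ 3) `^ (- (1 - alpha)).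
    by rewrite -powR_mulrn ?(ltW K0)// -powRrM /b; congr (_ `^ _); field.
  rewrite !powRN lef_pV2 ?posrE ?powR_gt0 ?exprn_gt0//.
  apply: ge0_ler_powR; rewrite ?nnegrE ?exprn_ge0 ?ler0n//; first lra.
  by rewrite -natrX ler_nat.
rewrite mulrCA (le_trans (ler_pM _ _ Yt tK)) ?mulr_ge0 ?powR_ge0 ?invr_ge0 ?ler0n//.
rewrite -mulrA -powRD ?(gt_eqF K0) ?implybT// -powRN.
by rewrite (_ : 2 + b - _ = - b)//; ring.
Qed.

Lemma cube_interpolation_cvg0 :
  (\forall k \near \oo, `|Y (k.+1 ^ 3)%N| <= k.+1%:R `^ (2 + b)) ->
  (fun t => t%:R `^ alpha * (`|Y t| / t%:R)) @ \oo --> (0 : R).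
Proof.
have alpha3 := alpha_lt; have b0 : 0 < b by rewrite /b; lra.
move=> [N _ YN]; apply/cvgrPdist_lt => e e0.
have /cvgrPdist_lt/(_ e e0)[M _ tail] :
    (1 + 7 * L) * riemannR b k @[k --> \oo] --> (0 : R).
  by rewrite -(mulr0 (1 + 7 * L)); apply: cvgMr; exact: riemannR_cvg0.
exists ((maxn M N).+1 ^ 3)%N => // t /= Mt.
have [k /andP[kt tk]] := expn_bracket t (isT : (0 < 3)%N).
have : ((maxn M N).+1 < k.+1)%N.
  by rewrite -(ltn_exp2r _ _ (isT : (0 < 3)%N)) (leq_ltn_trans Mt).
case: k kt tk => // k kt tk; rewrite !ltnS geq_max => /andP[Mk Nk].
rewrite sub0r normrN ger0_norm ?mulr_ge0 ?powR_ge0 ?invr_ge0 ?ler0n//.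
apply: le_lt_trans (cube_interpolation_le _ _ (YN _ Nk)) _; rewrite ?kt//.
by have := tail _ Mk; rewrite sub0r normrN; apply: le_lt_trans; exact: ler_norm.
Qed.

End cube_interpolation.

Section cylinders.
Context (d' : measure_display) (T' : measurableType d').
Variables (T : Type) (I : choiceType) (X : I -> T -> T').

Definition cylinders (J : set I) : set (set T) :=
  [set A | exists (K : {fset I}) (B : I -> set T'),
    [/\ [set` K] `<=` J, forall i, measurable (B i) &
        A = \bigcap_(i in [set` K]) X i @^-1` B i]].

Lemma cylinders_setT J : cylinders J setT.
Proof.
exists fset0, (fun=> setT); split=> //.
by apply/esym/seteqP; split.
Qed.

Lemma cylinders_setI J : setI_closed (cylinders J).
Proof.
move=> _ _ [K1 [B1 [K1J mB1 ->]]] [K2 [B2 [K2J mB2 ->]]].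
pose C (K : {fset I}) (B : I -> set T') i := if i \in K then B i else setT.
exists (K1 `|` K2)%fset, (fun i => C K1 B1 i `&` C K2 B2 i); split.
- by move=> i /=; rewrite inE => /orP[/K1J|/K2J].
- by move=> i; apply: measurableI; rewrite /C; case: ifP.
- apply/seteqP; split=> x.
    move=> [X1 X2] i /= _; rewrite /C; split; case: ifP => // Ki.
      exact: X1.
    exact: X2.
  move=> X12; split=> i /= Ki; have := X12 i; rewrite /C /= inE Ki ?orbT/=.
    by move=> /(_ isT)[].
  by move=> /(_ isT)[].
Qed.

Lemma sub_cylinders J1 J2 : J1 `<=` J2 -> cylinders J1 `<=` cylinders J2.
Proof.
move=> J12 _ [K [B [KJ mB ->]]]; exists K, B; split=> //.
exact: subset_trans J12.
Qed.

End cylinders.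

Lemma big_fsetU_disjoint (R : Type) (idx : R) (op : Monoid.com_law idx)
    (I : choiceType) (A B : {fset I}) (F : I -> R) :
  (forall i, i \in B -> i \notin A) ->
  \big[op/idx]_(i <- (A `|` B)%fset) F i =
  op (\big[op/idx]_(i <- A) F i) (\big[op/idx]_(i <- B) F i).
Proof.
move=> AB; rewrite -big_cat; apply: perm_big; apply: uniq_perm.
- exact: fset_uniq.
- by rewrite cat_uniq !fset_uniq andbT /=; apply/hasPn.
- by move=> i; rewrite mem_cat inE.
Qed.

Section independence.
Context (d : measure_display) (T : measurableType d) (R : realType).
Variable P : probability T R.
Local Open Scope ereal_scope.

Definition independent_events (A B : set T) : Prop :=
  P (A `&` B) = P A * P B.

Lemma independent_events_sym A B :
  independent_events A B -> independent_events B A.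
Proof. by rewrite /independent_events setIC muleC. Qed.

Lemma independent_g_sigma_algebra (G : set (set T)) B :
  G `<=` measurable -> G setT -> setI_closed G -> measurable B ->
  (forall A, G A -> independent_events A B) ->
  forall A, <<s G >> A -> independent_events A B.
Proof.
move=> Gm GT GI mB indGB A sGA; rewrite /independent_events.
pose restr := mrestr P mB.
pose scale := mscale (NngNum (fine_ge0 (measure_ge0 P B))) P.
have scaleE C : measurable C -> scale C = P C * P B.
  by move=> mC; rewrite /scale /mscale/= fineK ?fin_num_measure// muleC.
have mA : measurable A.
  by move: A sGA; exact: smallest_sub (@sigma_algebra_measurable _ T) Gm.
rewrite -scaleE//.
apply: (@g_sigma_algebra_measure_unique _ _ _ G Gm (fun=> setT) _ _ restr scale).
- by [].
- exact: bigcup_const.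
- exact: GI.
- by move=> C GC; exact: etrans (indGB _ GC) (esym (scaleE _ (Gm _ GC))).
- move=> _; apply: (@le_lt_trans _ _ 1); last exact: ltry.
  by rewrite /= /restr /mrestr setTI probability_le1.
- exact: sGA.
Qed.

Context (d' : measure_display) (T' : measurableType d') (I : choiceType).
Variables (D : set I) (X : I -> {RV P >-> T'}).
Hypothesis indX : mutually_independent D X.

Lemma measurable_cylinders J : cylinders X J `<=` measurable.
Proof.
move=> _ [K [B [_ mB ->]]]; apply: fin_bigcap_measurable => [|i _].
  exact: finite_fset.
exact: measurable_funPTI.
Qed.

Lemma independent_cylinders J1 J2 : J1 `<=` D -> J2 `<=` D -> J1 `&` J2 = set0 ->
  forall A B, cylinders X J1 A -> cylinders X J2 B -> independent_events A B.
Proof.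
move=> J1D J2D J12 _ _ [K1 [B1 [K1J mB1 ->]]] [K2 [B2 [K2J mB2 ->]]].
have K2N1 i : i \in K2 -> i \notin K1.
  move=> /K2J J2i; apply/negP => /K1J J1i.
  by have : (J1 `&` J2) i by []; rewrite J12.
have K1D i : i \in K1 -> D i by move=> /K1J/J1D.
have K2D i : i \in K2 -> D i by move=> /K2J/J2D.
pose B i := if i \in K1 then B1 i else B2 i.
have mB i : measurable (B i) by rewrite /B; case: ifP.
have -> : \bigcap_(i in [set` K1]) X i @^-1` B1 i =
    \bigcap_(i in [set` K1]) X i @^-1` B i.
  by apply: eq_bigcapr => i /= K1i; rewrite /B K1i.
have -> : \bigcap_(i in [set` K2]) X i @^-1` B2 i =
    \bigcap_(i in [set` K2]) X i @^-1` B i.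
  by apply: eq_bigcapr => i /= K2i; rewrite /B (negbTE (K2N1 _ K2i)).
rewrite /independent_events.
rewrite -bigcap_setU (_ : [set` K1] `|` _ = [set` (K1 `|` K2)%fset]); last first.
  by apply/seteqP; split=> i; rewrite /= inE => /orP.
rewrite (indX K1D)// (indX K2D)// indX// => [|i].
  by rewrite big_fsetU_disjoint.
by rewrite inE => /orP[/K1D|/K2D].
Qed.

Lemma independent_sigma_cylinders J B : measurable B ->
  (forall A, cylinders X J A -> independent_events A B) ->
  forall A, <<s cylinders X J >> A -> independent_events A B.
Proof.
apply: independent_g_sigma_algebra; first exact: measurable_cylinders.
  exact: cylinders_setT.
exact: cylinders_setI.
Qed.

Lemma mutually_independent_disjoint J1 J2 :
  J1 `<=` D -> J2 `<=` D -> J1 `&` J2 = set0 ->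
  forall A B, <<s cylinders X J1 >> A -> <<s cylinders X J2 >> B ->
  independent_events A B.
Proof.
move=> J1D J2D J12 A B sA sB; apply: independent_events_sym.
apply: independent_sigma_cylinders sB => [|{}B cB].
  move: A sA; apply: smallest_sub; first exact: sigma_algebra_measurable.
  exact: measurable_cylinders.
apply: independent_events_sym; apply: independent_sigma_cylinders sA => [|C cC].
  exact: measurable_cylinders cB.
exact: independent_cylinders cC cB.
Qed.

End independence.

Lemma borel_cantelli_ae (d : measure_display) (T : measurableType d) (R : realType)
    (mu : {measure set T -> \bar R}) (F : (set T)^nat) :
  (forall k, measurable (F k)) -> (\sum_(k <oo) mu (F k) < +oo)%E ->
  {ae mu, forall x, \forall k \near \oo, ~ F k x}.
Proof.
move=> mF sumF; exists (lim_sup_set F); split.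
- by apply: bigcapT_measurable => n; apply: bigcup_measurable.
- exact: lim_sup_set_cvg0.
- move=> x /= xF n _; apply: contrapT => nFx; apply: xF.
  by exists n => // k nk Fk; apply: nFx; exists k.
Qed.

Lemma Lfun1_indic (d : measure_display) (T : measurableType d) (R : realType)
    (mu : {finite_measure set T -> \bar R}) (A : set T) :
  measurable A -> \1_A \in Lfun mu 1.
Proof. by move=> mA; apply/Lfun1_integrable; exact: integrable_indic. Qed.

Section finitely_valued.
Context (d : measure_display) (T : measurableType d) (R : realType).
Variables (P : probability T R) (K : choiceType) (Z : T -> K) (s : seq K).
Hypothesis s_uniq : uniq s.
Hypothesis Z_in : forall x, Z x \in s.
Hypothesis mZ : forall k, measurable (Z @^-1` [set k]).
Implicit Type f : K -> R.

Lemma comp_sum_indic f :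
  f \o Z = \sum_(k <- s) f k \o* \1_(Z @^-1` [set k]).
Proof.
apply/funext => x; rewrite fct_sumE (bigD1_seq (Z x))//= big1 ?addr0.
  by rewrite indicE mem_set ?mul1r.
by move=> k /eqP kZ; rewrite indicE memNset ?mul0r//= => /esym.
Qed.

Lemma Lfun1_comp f : f \o Z \in Lfun P 1.
Proof.
by rewrite comp_sum_indic; apply: rpred_sum => k _; exact/Lfun_scale/Lfun1_indic.
Qed.

Lemma expectation_comp f :
  ('E_P[f \o Z] = (\sum_(k <- s) f k * fine (P (Z @^-1` [set k])))%R%:E)%E.
Proof.
have Lindic k : \1_(Z @^-1` [set k]) \in Lfun P 1 by exact: Lfun1_indic.
rewrite comp_sum_indic -(big_map (fun k => f k \o* \1_(Z @^-1` [set k])) xpredT id).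
rewrite expectation_sum => [|_ /mapP[k _ ->]]; last exact: Lfun_scale.
rewrite big_map -sumEFin; apply: eq_bigr => k _.
by rewrite expectationZl// expectation_indic// EFinM fineK// fin_num_measure.
Qed.

End finitely_valued.

Lemma probability_preimage_fset (d : measure_display) (T : measurableType d)
    (R : realType) (P : probability T R) (X : {RV P >-> nat})
    (G : {fset nat}) (p : R) :
  (forall k, k \in G -> P (X @^-1` [set k]) = p%:E) ->
  P (X @^-1` [set` G]) = (p *+ #|` G|)%:E.
Proof.
move=> Xp; rewrite -[[set` G]]image_id -bigcup_imset1 preimage_bigcup.
rewrite measure_fin_bigcup//.
- rewrite -fsbig_seq// (eq_big_seq (fun=> p%:E))// sumEFin.
  by rewrite big_const_seq count_predT iter_addr_0.
- exact: trivIset_preimage1.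
- by move=> k _; exact: measurable_funPTI.
Qed.

Lemma cvg_series_lty (R : realType) (u : R^nat) :
  cvgn (series u) -> (\sum_(k <oo) (u k)%:E < +oo)%E.
Proof.
move=> cu; rewrite (_ : (fun n => _) = EFin \o series u); last first.
  by apply/funext => n; rewrite /= sumEFin.
by rewrite EFin_lim// ltry.
Qed.

Lemma measurable_norm_ge (d : measure_display) (T : measurableType d)
    (R : realType) (Y : {mfun T >-> R}) (c : R) : measurable [set x | c <= `|Y x|].
Proof.
rewrite -[X in measurable X]setTI.
rewrite (_ : [set x | _] = (Num.norm \o Y) @^-1` [set` `[c, +oo[]).
  exact: measurableT_comp.
by apply/seteqP; split=> x; rewrite /= in_itv/= andbT.
Qed.

Lemma markov_sqr (d : measure_display) (T : measurableType d) (R : realType)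
    (P : probability T R) (Y : {RV P >-> R}) (c : R) : 0 < c ->
  (P [set x | (c <= `|Y x|)%R] <= (c ^- 2)%:E * 'E_P[fun x => (Y x ^+ 2)%R])%E.
Proof.
move=> c0; rewrite lee_pdivlMl ?exprn_gt0//.
rewrite (_ : (fun x => _) = (fun r => r ^+ 2) \o Num.norm \o Y); last first.
  by apply/funext => x; rewrite /= real_normK ?num_real.
apply: markov => //; first by move=> r _; exact: sqr_ge0.
by move=> x y x0 y0; rewrite ler_sqr.
Qed.

Lemma markov_cube (d : measure_display) (T : measurableType d) (R : realType)
    (P : probability T R) (Y : {RV P >-> R}) (C b : R) (k : nat) :
  ('E_P[fun x => (Y x ^+ 2)%R] <= (C * (k.+1 ^ 3)%:R)%:E)%E ->
  (P [set x | (k.+1%:R `^ (2 + b) <= `|Y x|)%R] <=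
   (C * riemannR (1 + 2 * b) k)%:E)%E.
Proof.
move=> Y_sqr; have k0 : (0 : R) < k.+1%:R by [].
apply: le_trans (markov_sqr Y (powR_gt0 (2 + b) k0)) _.
apply: le_trans (lee_wpmul2l _ Y_sqr) _; first by rewrite lee_fin invr_ge0 sqr_ge0.
suff <- : (k.+1%:R `^ (2 + b)) ^- 2 * (k.+1 ^ 3)%:R = riemannR (1 + 2 * b) k.
  by rewrite -EFinM mulrCA.
rewrite natrX -!powR_mulrn ?(ltW k0) ?powR_ge0// -powRrM -powRN.
rewrite -powRD ?(gt_eqF k0) ?implybT// /riemannR -powRN.
by congr (_ `^ _); ring.
Qed.

Lemma ae_cvg0_second_moment (d : measure_display) (T : measurableType d)
    (R : realType) (P : probability T R) (Y : nat -> {RV P >-> R}) (L C alpha : R) :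
  alpha < 1 / 3 ->
  (forall t x, `|Y t.+1 x - Y t x| <= L) ->
  (forall t, ('E_P[fun x => (Y t x ^+ 2)%R] <= (C * t%:R)%:E)%E) ->
  {ae P, forall x,
    (fun t => t%:R `^ alpha * (`|Y t x| / t%:R)) @ \oo --> (0 : R)}.
Proof.
move=> alpha3 Y_incr Y_sqr; pose b := (1 - 3 * alpha) / 2.
have b0 : 0 < b by rewrite /b; lra.
pose F k := [set x | k.+1%:R `^ (2 + b) <= `|Y (k.+1 ^ 3)%N x|].
have mF k : measurable (F k) by exact: measurable_norm_ge.
have PF k : (P (F k) <= (C * riemannR (1 + 2 * b) k)%:E)%E.
  exact: markov_cube.
have sumF : (\sum_(k <oo) P (F k) < +oo)%E.
  apply: le_lt_trans (lee_nneseries _ (fun k _ => PF k)) _ => //.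
  apply: cvg_series_lty; apply: is_cvg_seriesZ; apply: cvg_riemannR.
  lra.
apply: filterS (borel_cantelli_ae mF sumF) => x nF.
apply: cube_interpolation_cvg0 => //.
by apply: filterS nF => k /negP; rewrite -ltNge => /ltW.
Qed.

Section greedy_indep.
Variables (m : nat) (s : nat -> 'I_m -> nat).

Definition avoids (c : 'I_m -> nat) (G : {fset nat}) : bool :=
  [forall j, c j \notin G].

Definition vertices (t : nat) : {fset nat} := [fset k in iota 1 t]%fset.

Lemma mem_vertices t k : (k \in vertices t) = (0 < k <= t)%N.
Proof. by rewrite !inE mem_iota add1n ltnS. Qed.

Lemma fsubset_vertices_card t G : (G `<=` vertices t)%fset -> (#|` G| <= t)%N.
Proof.
by move/fsubset_leq_card; rewrite card_fseq undup_id ?iota_uniq// size_iota.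
Qed.

Lemma fsubset_verticesS t G : (G `<=` vertices t -> G `<=` vertices t.+1)%fset.
Proof.
move/fsubset_trans; apply; apply/fsubsetP => k; rewrite !mem_vertices.
by move=> /andP[-> /leqW].
Qed.

Lemma fsubset_vertices_notin t G : (G `<=` vertices t)%fset -> t.+1 \notin G.
Proof. by move=> /fsubsetP Gt; apply/negP => /Gt; rewrite mem_vertices ltnn. Qed.

Lemma greedy_indepS t : greedy_indep s t.+1 =
  if avoids (s t.+1) (greedy_indep s t)
  then (t.+1 |` greedy_indep s t)%fset else greedy_indep s t.
Proof.
case: t => //=; rewrite (_ : avoids _ _); first by rewrite fsetU0.
exact/forallP.
Qed.

Lemma greedy_indep_sub t : (greedy_indep s t `<=` vertices t)%fset.
Proof.
elim: t => [|t IH]; first exact: fsub0set.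
rewrite greedy_indepS; case: ifP => _; last exact: fsubset_verticesS.
by rewrite fsubUset fsub1set mem_vertices leqnn fsubset_verticesS.
Qed.

Lemma greedy_indepS_eq t G : greedy_indep s t.+1 = G <->
  if t.+1 \in G
  then greedy_indep s t = (G `\ t.+1)%fset /\ avoids (s t.+1) (G `\ t.+1)%fset
  else greedy_indep s t = G /\ ~~ avoids (s t.+1) G.
Proof.
have new := fsubset_vertices_notin (greedy_indep_sub t).
rewrite greedy_indepS; split.
  case: ifPn => [av|av] <-; last by rewrite (negbTE new).
  by rewrite fset1U1 fsetU1K.
case: ifP => tG [-> av].
  by rewrite av fsetD1K.
by rewrite (negbTE av).
Qed.

End greedy_indep.

(* The expected square after a step of mean [q - w], whose drift opposes [y]; the
   remaining term is the variance of a single indicator. *)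
Lemma mean_sqr_step_le (R : realType) (w q y : R) : 0 <= w <= 1 -> 0 <= q <= 1 ->
  y * (q - w) <= 0 ->
  (1 - q) * (y - w) ^+ 2 + q * (y + 1 - w) ^+ 2 <= y ^+ 2 + 1.
Proof.
move=> /andP[w0 w1] /andP[q0 q1] drift.
have sqr_w : w ^+ 2 <= 1 by rewrite exprn_ile1.
have sqr_1w : (1 - w) ^+ 2 <= 1 by rewrite exprn_ile1 ?subr_ge0// gerBl.
nra.
Qed.

Section deviation.
Variable R : realType.

Definition avoid_prob m t (G : {fset nat}) : R := (1 - #|` G|%:R / t%:R) ^+ m.

Definition deviation (w : R) t (G : {fset nat}) : R := #|` G|%:R - w * t%:R.

Lemma deviationS w t G : deviation w t.+1 G = deviation w t G - w.
Proof. by rewrite /deviation -natr1; ring. Qed.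

Variables (m t : nat) (G : {fset nat}).
Hypothesis GV : (G `<=` vertices t)%fset.

Lemma deviationU1 w : deviation w t.+1 (t.+1 |` G)%fset = deviation w t G + 1 - w.
Proof.
rewrite deviationS /deviation cardfsU1 fsubset_vertices_notin// add1n -natr1.
by ring.
Qed.

Lemma density_itv : 0 <= (#|` G|%:R / t%:R : R) <= 1.
Proof.
rewrite divr_ge0//=; have [->|t0] := posnP t; first by rewrite invr0 mulr0.
by rewrite ler_pdivrMr ?ltr0n// mul1r ler_nat fsubset_vertices_card.
Qed.

Lemma avoid_prob_itv : 0 <= avoid_prob m t G <= 1.
Proof.
have /andP[x0 x1] := density_itv.
by rewrite /avoid_prob exprn_ge0 ?exprn_ile1 ?subr_ge0// gerBl.
Qed.

Lemma deviationE w : deviation w t G = (#|` G|%:R / t%:R - w) * t%:R.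
Proof.
rewrite /deviation mulrBl; congr (_ - _).
have [t0|t0] := posnP t; last by rewrite divfK// pnatr_eq0 -lt0n.
by have := fsubset_vertices_card GV; rewrite t0 leqn0 mulr0 => /eqP ->.
Qed.

Lemma deviation_sqrS_le w : 0 <= w <= 1 -> (1 - w) ^+ m = w ->
  (1 - avoid_prob m t G) * deviation w t.+1 G ^+ 2 +
    avoid_prob m t G * deviation w t.+1 (t.+1 |` G)%fset ^+ 2 <=
  deviation w t G ^+ 2 + 1.
Proof.
move=> w01 wE; rewrite deviationS deviationU1; apply: mean_sqr_step_le => //.
  exact: avoid_prob_itv.
rewrite deviationE mulrAC mulr_le0_ge0//.
have [/andP[_ w1] /andP[_ x1]] := (w01, density_itv).
exact: fixpoint_onem_exp_drift.
Qed.

End deviation.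

Section greedy_process.
Context (R : realType) (m : nat) (d : measure_display) (T : measurableType d).
Variables (P : probability T R) (sel : nat -> 'I_m -> {RV P >-> nat}).

Definition greedy_process t x : {fset nat} :=
  greedy_indep (fun v j => sel v j x) t.

Definition avoid_event v (G : {fset nat}) : set T :=
  [set x | avoids (fun j => sel v j x) G].

Definition selections (i : nat * 'I_m) : {RV P >-> nat} := sel i.1 i.2.

Definition past t : set (nat * 'I_m) := [set i | (1 < i.1 <= t)%N].

Definition present t : set (nat * 'I_m) := [set i | i.1 = t].

Lemma avoid_eventE v G : avoid_event v G =
  \bigcap_(i in [set` [fset (v, j) | j in 'I_m]%fset])
    selections i @^-1` ~` [set` G].
Proof.
apply/seteqP; split=> x /=.
  by move=> /forallP av _ /imfsetP[j _ ->]; apply/negP/av.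
move=> av; apply/forallP => j; apply/negP; apply: (av (v, j)).
by apply/imfsetP; exists j.
Qed.

Lemma cylinders_avoid_event v G :
  cylinders selections (present v) (avoid_event v G).
Proof.
rewrite avoid_eventE; eexists _, (fun=> ~` [set` G]); split; last by [].
  by move=> _ /imfsetP[j _ ->].
by [].
Qed.

Lemma greedy_process_eventS t G : greedy_process t.+1 @^-1` [set G] =
  if t.+1 \in G
  then greedy_process t @^-1` [set G `\ t.+1]%fset `&`
    avoid_event t.+1 (G `\ t.+1)%fset
  else (greedy_process t @^-1` [set G]) `\` avoid_event t.+1 G.
Proof.
apply/seteqP; split=> x.
  move/greedy_indepS_eq; case: ifP => _ [procE av]; split=> //.
  exact/negP.
move=> h; apply/greedy_indepS_eq; move: h; case: ifP => _ [procE av]; split=> //.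
exact/negP.
Qed.

Lemma greedy_process_adapted t G :
  <<s cylinders selections (past t) >> (greedy_process t @^-1` [set G]).
Proof.
have cst_adapted u (H K : {fset nat}) :
    <<s cylinders selections (past u) >> (cst H @^-1` [set K]).
  rewrite preimage_cst; case: ifP => _; last exact: sigma_algebra0.
  by apply: sub_sigma_algebra; exact: cylinders_setT.
case: t => [|t]; first exact: (cst_adapted 0 fset0 G).
elim: t G => [|t IH] G; first exact: (cst_adapted 1 [fset 1]%fset G).
pose F := g_sigma_algebraType (cylinders selections (past t.+2)).
have measurable_proc H : measurable (greedy_process t.+1 @^-1` [set H] : set F).
  apply: (sub_sigma_algebra2 _ (IH H)); apply: sub_cylinders => i /andP[i1 it].
  by apply/andP; rewrite leqW.
have measurable_avoid H : measurable (avoid_event t.+2 H : set F).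
  apply: sub_sigma_algebra; apply: sub_cylinders (cylinders_avoid_event _ _).
  by move=> i /= iv; rewrite /past /= iv leqnn.
rewrite greedy_process_eventS; case: ifP => _.
  exact: (measurableI _ _ (measurable_proc _) (measurable_avoid _)).
exact: (measurableD (measurable_proc _) (measurable_avoid _)).
Qed.

Lemma measurable_greedy_process t G : measurable (greedy_process t @^-1` [set G]).
Proof.
move: (@greedy_process_adapted t G); apply: smallest_sub.
  exact: sigma_algebra_measurable.
exact: measurable_cylinders.
Qed.

Lemma measurable_avoid_event v G : measurable (avoid_event v G).
Proof. exact: measurable_cylinders (cylinders_avoid_event v G). Qed.

Lemma greedy_process_in t x :
  greedy_process t x \in enum_fset (fpowerset (vertices t)).
Proof. by rewrite fpowersetE greedy_indep_sub. Qed.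

Lemma Lfun1_greedy t (f : {fset nat} -> R) : f \o greedy_process t \in Lfun P 1.
Proof.
apply: Lfun1_comp (fset_uniq _) (@greedy_process_in t) _ f => G.
exact: measurable_greedy_process.
Qed.

Lemma measurable_greedy t (f : {fset nat} -> R) :
  measurable_fun setT (f \o greedy_process t).
Proof. by have /sub_Lfun_mfun := Lfun1_greedy t f; rewrite inE. Qed.

Lemma expectation_greedy t (f : {fset nat} -> R) :
  ('E_P[f \o greedy_process t] = (\sum_(G <- fpowerset (vertices t))
    f G * fine (P (greedy_process t @^-1` [set G])))%R%:E)%E.
Proof.
apply: expectation_comp (fset_uniq _) (@greedy_process_in t) _ f => G.
exact: measurable_greedy_process.
Qed.

Definition greedy_deviation w t : T -> R := deviation w t \o greedy_process t.

HB.instance Definition _ w t := isMeasurableFun.Build _ _ _ _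
  (greedy_deviation w t) (measurable_greedy t (deviation w t)).

Lemma greedy_deviation_incr w t x : 0 <= w <= 1 ->
  `|greedy_deviation w t.+1 x - greedy_deviation w t x| <= 1.
Proof.
move=> w01; rewrite /greedy_deviation/= /greedy_process greedy_indepS.
case: ifP => _; rewrite ?deviationU1 ?greedy_indep_sub ?deviationS//.
  by rewrite (_ : _ - _ = 1 - w) ?ler_norml; [lra|ring].
by rewrite (_ : _ - _ = - w) ?ler_norml; [lra|ring].
Qed.

Hypothesis hsel : uniform_attachment sel.

Lemma probability_avoid_event t G : (0 < t)%N -> (G `<=` vertices t)%fset ->
  P (avoid_event t.+1 G) = (avoid_prob R m t G)%:E.
Proof.
move=> t0 Gt; have [unif ind] := hsel.
rewrite avoid_eventE (ind _ (fun=> ~` [set` G]))//; last first.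
  by move=> _ /imfsetP[j _ ->]; rewrite /= ltnS.
rewrite (eq_big_seq (fun=> (1 - #|` G|%:R / t%:R)%:E)) => [|_ /imfsetP[j _ ->]].
  rewrite prodEFin big_const_seq count_predT iter_mulr_1 card_imfset => [|i j []//].
  by rewrite -cardE card_ord.
rewrite -preimage_setC probability_setC; last exact: measurable_funPTI.
rewrite (probability_preimage_fset (p := t%:R^-1)) ?mulr_natl// => k kG.
by rewrite unif// -mem_vertices (fsubsetP Gt).
Qed.

(* At [t = 0] the selections of vertex 1 are unconstrained, but then [G] is empty
   and [avoid_prob] is 1, as [x / 0 = 0]. *)
Lemma probability_greedy_avoid t G : (G `<=` vertices t)%fset ->
  P (greedy_process t @^-1` [set G] `&` avoid_event t.+1 G) =
  (P (greedy_process t @^-1` [set G]) * (avoid_prob R m t G)%:E)%E.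
Proof.
case: t => [|t] Gt.
  have -> : G = fset0.
    by apply/eqP; rewrite -cardfs_eq0 -leqn0 fsubset_vertices_card.
  have -> : avoid_event 1 fset0 = setT.
    by apply/seteqP; split=> // x _; exact/forallP.
  by rewrite setIT /avoid_prob cardfs0 mul0r subr0 expr1n mule1.
rewrite -probability_avoid_event//; have [_ ind] := hsel.
apply: (mutually_independent_disjoint ind (J1 := past t.+1) (J2 := present t.+2)).
- by move=> i /andP[].
- by move=> i /= iv; rewrite /= iv.
- by apply/seteqP; split=> // i [/andP[_ it] /= iv]; move: it; rewrite iv ltnn.
- exact: greedy_process_adapted.
- by apply: sub_sigma_algebra; exact: cylinders_avoid_event.
Qed.

Lemma probability_greedy_not_avoid t G : (G `<=` vertices t)%fset ->
  P (greedy_process t @^-1` [set G] `\` avoid_event t.+1 G) =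
  (P (greedy_process t @^-1` [set G]) * (1 - avoid_prob R m t G)%:E)%E.
Proof.
move=> Gt; have mG := measurable_greedy_process t G.
have PG := fin_num_measure P _ mG.
rewrite measureD//; [|exact: measurable_avoid_event|by rewrite ltey_eq PG].
by rewrite EFinB muleBr// mule1 -probability_greedy_avoid.
Qed.

Definition greedy_transition t x : {fset nat} * bool :=
  (greedy_process t x, avoids (fun j => sel t.+1 j x) (greedy_process t x)).

Lemma greedy_transition_preimage t G b :
  greedy_transition t @^-1` [set (G, b)] =
  if b then greedy_process t @^-1` [set G] `&` avoid_event t.+1 G
  else greedy_process t @^-1` [set G] `\` avoid_event t.+1 G.
Proof.
apply/seteqP; split=> x; rewrite /greedy_transition /avoid_event /=.
  by case: b => -[<-]; [|move/negbT/negP].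
by case: b => /= -[<-]; [move=> ->|move/negP/negbTE ->].
Qed.

Lemma measurable_greedy_transition t Gb :
  measurable (greedy_transition t @^-1` [set Gb]).
Proof.
case: Gb => G b; have mG := measurable_greedy_process t G.
have mA := measurable_avoid_event t.+1 G.
by rewrite greedy_transition_preimage; case: b;
  [exact: measurableI|exact: measurableD].
Qed.

Lemma expectation_greedyS t (f : {fset nat} -> R) :
  ('E_P[f \o greedy_process t.+1] =
   'E_P[(fun G => (1 - avoid_prob R m t G) * f G +
     avoid_prob R m t G * f (t.+1 |` G)%fset)%R \o greedy_process t])%E.
Proof.
pose g (Gb : {fset nat} * bool) := f (if Gb.2 then (t.+1 |` Gb.1)%fset else Gb.1).
have -> : f \o greedy_process t.+1 = g \o greedy_transition t.
  by apply/funext => x; rewrite /g /= /greedy_process greedy_indepS.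
pose s := [seq (G, b) | G <- fpowerset (vertices t), b <- [:: true; false]].
have s_uniq : uniq s by rewrite allpairs_uniq ?fset_uniq// => -[? ?] [? ?].
have s_in x : greedy_transition t x \in s.
  apply/allpairsP; exists (greedy_transition t x); split=> //=.
    exact: greedy_process_in.
  by case: (avoids _ _).
rewrite (expectation_comp P s_uniq s_in (measurable_greedy_transition t)).
rewrite expectation_greedy big_allpairs_dep; congr (_%:E).
apply: eq_big_seq => G Gt; rewrite !big_cons big_nil /= addr0.
have PG := fin_num_measure P _ (measurable_greedy_process t G).
have GV : (G `<=` vertices t)%fset by rewrite -fpowersetE.
rewrite !greedy_transition_preimage probability_greedy_avoid//.
by rewrite probability_greedy_not_avoid// !fineM//= /g/=; ring.
Qed.

Lemma expectation_greedy_deviation_sqr w t : 0 <= w <= 1 -> (1 - w) ^+ m = w ->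
  ('E_P[fun x => (greedy_deviation w t x ^+ 2)%R] <= t%:R%:E)%E.
Proof.
move=> w01 wE; elim: t => [|t IH].
  rewrite (_ : (fun x => _) = cst 0) ?expectation_cst//.
  apply/funext => x; rewrite /greedy_deviation/= /deviation.
  by rewrite mulr0 subr0 cardfs0 expr0n.
rewrite (expectation_greedyS t (fun G => deviation w t.+1 G ^+ 2)).
pose sqr G := deviation w t G ^+ 2.
apply: (@le_trans _ _ ('E_P[((sqr \o greedy_process t) \+ cst 1)%R])%E).
  apply: expectation_le.
  - exact: measurable_greedy.
  - exact: (measurable_greedy t (fun G => sqr G + 1)).
  - move=> x; have GV := greedy_indep_sub (fun v j => sel v j x) t.
    have /andP[q0 q1] := avoid_prob_itv R m GV.
    by rewrite /= addr_ge0// mulr_ge0 ?sqr_ge0 ?subr_ge0.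
  - by move=> x; rewrite /= addr_ge0 ?sqr_ge0.
  - by apply: aeW => x; apply: deviation_sqrS_le => //; exact: greedy_indep_sub.
rewrite expectationD ?expectation_cst ?Lfun1_greedy ?Lfun_cst// -natr1 EFinD.
by rewrite leeD2r.
Qed.

End greedy_process.

Theorem theorem2p11 (R : realType) (m : nat) (hm : (1 <= m)%N)
    (d : measure_display) (T : measurableType d) (P : probability T R)
    (sel : nat -> 'I_m -> {RV P >-> nat}) (hsel : uniform_attachment sel) :
  exists w : R,
    unique (fun x : R => 0 < x < 1 /\ - x + (1 - x) ^+ m = 0) w /\
    forall alpha : R, alpha < 1 / 3 ->
      {ae P, forall omega : T,
        (fun t : nat =>
           t%:R `^ alpha *
           `| #|` greedy_indep (fun v j => sel v j omega) t|%:R / t%:R - w |)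
          @ \oo --> (0 : R)}.
Proof.
have [w wU] := unique_fixpoint_onem_exp R hm; exists w; split=> // alpha alpha3.
have [[/andP[w0 w1] w_root] _] := wU.
have w01 : 0 <= w <= 1 by rewrite !ltW.
have wE : (1 - w) ^+ m = w by lra.
have Y_sqr t :
    ('E_P[fun x => (greedy_deviation sel w t x ^+ 2)%R] <= (1 * t%:R)%:E)%E.
  by rewrite mul1r; exact: expectation_greedy_deviation_sqr.
have Y_incr t x := greedy_deviation_incr sel t x w01.
apply: filterS (ae_cvg0_second_moment alpha3 Y_incr Y_sqr) => x.
apply: cvg_trans; apply: near_eq_cvg; near=> t.
have t0 : (0 : R) < t%:R by rewrite ltr0n; near: t; exists 1%N.
rewrite -{2}(gtr0_norm t0) -normf_div.
by congr (_ * `|_|); rewrite /greedy_deviation/= /deviation mulrBl mulfK ?gt_eqF.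
Unshelve. all: by end_near.
Qed.
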